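(* Let $0<\alpha<1$, $1<p<\infty$, $T>0$, $0\le\mu<p-1$, and $\omega(t)=t^\mu$ on $(0,T)$. Then there exists a constant $C>0$ such that for every $y\in W^{2,p}_{t^\mu}(0,T)$, every integer $N\ge1$ with $\tau=T/N$ and $t_n=n\tau$, and every $1\le n\le N$, $$|D^\alpha y(t_n)-\delta_\tau^\alpha y(t_n)|\le C\,\tau^{2-\alpha-\frac{1+\mu}{p}}\,\|y\|_{W^{2,p}_{t^\mu}}.$$ In particular $C$ does not depend on $\tau$, $n$ or $y$.
   Context: For a weight (locally integrable function) $\omega:(0,T)\to[0,\infty)$, $L^p_\omega(0,T)$ has norm $\|y\|_{L^p_\omega}=\left(\int_0^T|y(t)|^p\omega(t)\,dt\right)^{1/p}$, and $W^{s,p}_\omega(0,T)=\{y\in L^p_\omega(0,T): y',\dots,y^{(s)}\in L^p_\omega(0,T)\}$ (weak derivatives) with norm $\|y\|_{W^{s,p}_\omega}=\left(\int_0^T\left(\sum_{k=0}^s|y^{(k)}(t)|^p\right)\omega(t)\,dt\right)^{1/p}$. $W^{2,p}_{t^\mu}$ denotes this space with $\omega(t)=t^\mu$. Functions in it are identified with their continuously differentiable representatives on $[0,T]$ (with $y'$ absolutely continuous). The Caputo derivative of order $\alpha\in(0,1)$ is $D^\alpha y(t)=\frac1{\Gamma(1-\alpha)}\int_0^t\frac{y'(s)}{(t-s)^\alpha}\,ds$. The L1 scheme on the grid $t_n=n\tau$, $n\ge1$, is $$\delta_\tau^\alpha y(t_n)=\frac{\tau^{-\alpha}}{\Gamma(2-\alpha)}\left(y(t_n)-b_{n-1}y(0)-\sum_{i=1}^{n-1}(b_{n-i-1}-b_{n-i})y(t_i)\right),\qquad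 b_i=(i+1)^{1-\alpha}-i^{1-\alpha}.$$ *)

(* Defs.v *)
From HB Require Import structures.
From mathcomp Require Import all_boot all_order all_algebra.
From mathcomp Require Import all_classical all_reals all_analysis.

Set Implicit Arguments.
Unset Strict Implicit.
Unset Printing Implicit Defensive.

Import Order.TTheory GRing.Theory Num.Theory.
Import numFieldNormedType.Exports.

Local Open Scope classical_set_scope.
Local Open Scope ring_scope.

Definition Gamma (R : realType) (x : R) : R :=
  (\int[@lebesgue_measure R]_(t in `]0%R, +oo[) (t `^ (x - 1) * expR (- t)))%R.

(* The test functions, i.e. the elements of C_c^oo(0, T). *)
Definition test_function (R : realType) (T : R) (phi : R -> R) : Prop :=
  [/\ forall (n : nat) (x : R), derivable (derive1n n phi) x 1,
      compact (closure [set x | phi x != 0]) &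
      closure [set x | phi x != 0] `<=` `]0, T[].

Definition is_weak_derivative (R : realType) (T : R) (k : nat) (y g : R -> R)
    : Prop :=
  [/\ locally_integrable `]0, T[ y,
      locally_integrable `]0, T[ g &
      forall phi : R -> R, test_function T phi ->
        (\int[@lebesgue_measure R]_(t in `]0%R, T[) (y t * derive1n k phi t))%R =
        (- 1) ^+ k *
        (\int[@lebesgue_measure R]_(t in `]0%R, T[) (g t * phi t))%R].

(* A representative of the k-th weak derivative on (0, T), which is unique up
   to null sets; it is meaningful only if a weak derivative exists. For k = 0
   it is y itself. *)
Definition weak_derivative (R : realType) (T : R) (k : nat) (y : R -> R)
    : R -> R :=
  if k is 0%N then y else xget (fun=> 0) [set g | is_weak_derivative T k y g].

Definition weighted_Lp (R : realType) (T p : R) (w y : R -> R) : Prop :=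
  measurable_fun `]0, T[ y /\
  (@lebesgue_measure R).-integrable `]0, T[
    (fun t => (`|y t| `^ p * w t)%:E).

Definition weighted_Wsp (R : realType) (T : R) (s : nat) (p : R)
    (w y : R -> R) : Prop :=
  weighted_Lp T p w y /\
  forall k : nat, (0 < k <= s)%N ->
    (exists g, is_weak_derivative T k y g) /\
    weighted_Lp T p w (weak_derivative T k y).

Definition weighted_Wsp_norm (R : realType) (T : R) (s : nat) (p : R)
    (w y : R -> R) : R :=
  (\int[@lebesgue_measure R]_(t in `]0%R, T[)
     ((\sum_(k < s.+1) `|weak_derivative T k y t| `^ p) * w t))%R `^ p^-1.

(* y is continuously differentiable on [0, T]: y is continuous on [0, T],
   differentiable on (0, T), and y' extends continuously to [0, T]. The values
   of y outside [0, T] are irrelevant. *)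
Definition C1_on (R : realType) (T : R) (y : R -> R) : Prop :=
  derivable_oo_LRcontinuous y 0 T /\
  exists dy : R -> R, {within `[0, T], continuous dy} /\
                      {in `]0, T[, derive1 y =1 dy}.

Definition caputo (R : realType) (alpha : R) (y : R -> R) (t : R) : R :=
  (Gamma (1 - alpha))^-1 *
  (\int[@lebesgue_measure R]_(s in `]0%R, t[)
     (derive1 y s / (t - s) `^ alpha))%R.

Definition L1_coef (R : realType) (alpha : R) (i : nat) : R :=
  i.+1%:R `^ (1 - alpha) - i%:R `^ (1 - alpha).

(* The value at the grid point n * tau, for 1 <= n; the subtractions between
   indices are then exact. *)
Definition L1_scheme (R : realType) (alpha tau : R) (y : R -> R) (n : nat) : R :=
  tau `^ (- alpha) / Gamma (2 - alpha) *
  (y (n%:R * tau) - L1_coef alpha (n - 1) * y 0 -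
   \sum_(1 <= i < n)
     (L1_coef alpha (n - i - 1) - L1_coef alpha (n - i)) * y (i%:R * tau)).

(* Main.v *)
(* The error on (0, t_n) is, up to the factor 1 / Gamma(1 - alpha), the sum over
   the cells I_k of the integral of (y' - d_k) k, where k(s) = (t_n - s)^(-alpha)
   and d_k is the mean of y' on I_k; here Gamma(2 - alpha) = (1 - alpha)
   Gamma(1 - alpha) identifies the weights of the L1 scheme with cell integrals
   of k. As y' - d_k has mean zero, k may be replaced on I_k by k minus its value
   at the left end, and since k increases the resulting bounds telescope to
   tau^(1 - alpha) / (1 - alpha) times the maximal oscillation of y' on a cell.
   By Hoelder's inequality this oscillation is O(tau^(1 - (1 + mu) / p)) times the
   norm of y, t^(-mu / (p - 1)) being integrable; its integral over a cell is
   largest, up to a constant, on the first cell. That y' is a primitive of the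
   weak second derivative is seen by testing with smooth plateaus that tend to
   the indicator of an interval: their derivatives are two approximate identities
   at its ends. *)
Require Import Defs.
From HB Require Import structures.
From mathcomp Require Import all_boot all_order all_algebra.
From mathcomp Require Import all_classical all_reals all_analysis.
From mathcomp Require Import measurable_realfun ring lra.
Import Order.TTheory GRing.Theory Num.Theory.
Import numFieldNormedType.Exports.
Local Open Scope classical_set_scope.
Local Open Scope ring_scope.

Set Implicit Arguments.
Unset Strict Implicit.
Unset Printing Implicit Defensive.

(** * Smooth steps *)

Section smooth_step.
Context {R : realType}.
Implicit Types (f g : R -> R) (P Q : {poly R}) (x : R).

(** Each monomial [x ^+ i] is at most i factorial times [expR x], by the exponential series. This
    serves the flatness of [flat_exp] at 0 and the decay of the Gamma integrand at infinity. *)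
Lemma poly_expRN_bounded P :
  exists2 C, 0 <= C & forall x, 0 <= x -> `|P.[x] * expR (- x)| <= C.
Proof.
exists (\sum_(i < size P) `|P`_i| * (i`!)%:R).
  by apply: sumr_ge0 => i _; rewrite mulr_ge0.
move=> x x0; rewrite horner_coef mulr_suml (le_trans (ler_norm_sum _ _ _))//.
apply: ler_sum => i _; rewrite -mulrA normrM ler_wpM2l//.
rewrite ger0_norm ?mulr_ge0 ?exprn_ge0 ?expR_ge0// expRN ler_pdivrMr ?expR_gt0//.
case: (nat_of_ord i) => [|n].
  by rewrite expr0 fact0 mul1r (le_trans _ (expR_ge1Dx _))// lerDl.
rewrite -ler_pdivrMl ?ltr0n ?fact_gt0// mulrC.
by rewrite (le_trans _ (expR_ge1Dxn n x0))// lerDr.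
Qed.

(** The bound forces [f 0 = 0] and makes the difference quotient at 0 at most [C * |h|]. It settles
    differentiability of [flat_exp] where its two pieces meet. *)
Lemma is_derive_0_sqr f (C : R) :
  (forall x, `|f x| <= C * x ^+ 2) -> is_derive (0 : R) (1 : R) f (0 : R).
Proof.
move=> fC.
have f0 : f 0 = 0 by apply/eqP; rewrite -normr_le0 (le_trans (fC _))// expr0n mulr0.
have C0 : 0 <= C by have := fC 1; rewrite expr1n mulr1; exact: le_trans.
have : h^-1 *: (f (h *: (1 : R) + 0) - f 0) @[h --> 0^'] --> (0 : R).
  apply/cvgr0Pnorm_le => e e0; near=> h.
  have h0 : h != 0 by near: h; exact: nbhs_dnbhs_neq.
  rewrite f0 subr0 addr0 -[h *: 1]/(h * 1) mulr1 normrZ normfV.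
  rewrite ler_pdivrMl ?normr_gt0// (le_trans (fC h))//.
  rewrite -(real_normK (num_real _)) expr2 mulrA mulrC ler_wpM2l//.
  (* [C] may be 0, hence the denominator [C + 1]. *)
  have h1 : `|h| <= e / (C + 1).
    by near: h; apply: dnbhs0_le; rewrite divr_gt0// ltr_wpDl.
  apply: (@le_trans _ _ (C * (e / (C + 1)))); first exact: ler_wpM2l.
  by rewrite mulrCA ler_piMr ?(ltW e0)// ler_pdivrMr ?ltr_wpDl// mul1r lerDl.
by move=> h; apply: DeriveDef; [apply/cvg_ex; exists 0|apply/cvg_lim].
Unshelve. all: by end_near. Qed.

(* The functions [P (1/x) exp (-1/x)] extended by 0 to [x <= 0] are stable under
   derivation, the derivative corresponding to ['X^2 * (P - P')]. *)
Definition flat_exp P x : R := if 0 < x then P.[x^-1] * expR (- x^-1) else 0.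

Lemma flat_exp_le0 P x : x <= 0 -> flat_exp P x = 0.
Proof. by rewrite /flat_exp leNgt => /negbTE ->. Qed.

Lemma flat_exp_ge0 P x : (forall y, 0 <= P.[y]) -> 0 <= flat_exp P x.
Proof. by rewrite /flat_exp => P0; case: ifP => // _; rewrite mulr_ge0// expR_ge0. Qed.

Lemma is_derive_flat_exp P x :
  is_derive x 1 (flat_exp P) (flat_exp ('X^2 * (P - P^`())) x).
Proof.
have [x0|x0|->] := ltgtP x 0.
- rewrite flat_exp_le0 ?ltW//.
  apply: (@near_eq_is_derive _ _ _ (cst 0)) => //.
  near=> y; rewrite flat_exp_le0// ltW//.
  by near: y; exact: lt_nbhsl.
- rewrite /flat_exp x0.
  have xN0 : x != 0 by rewrite gt_eqF.
  have dinv : is_derive x 1 (fun y => (id y)^-1) (- x ^- 2 *: 1).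
    exact: is_deriveV.
  have dinvN : is_derive x 1 (- (fun y => (id y)^-1)) (- (- x ^- 2 *: 1)).
    exact: is_deriveN.
  apply: (@near_eq_is_derive _ _ _ ((horner P \o (fun y => (id y)^-1)) *
      (expR \o (- (fun y => (id y)^-1))))).
    near=> y; have -> // : 0 < y.
    by near: y; exact: lt_nbhsr.
  pose v : R -> R := - (fun y => (id y)^-1).
  have dP : is_derive x 1 (horner P \o (fun y => (id y)^-1))
      (P^`().[x^-1] * (- x ^- 2 *: 1)) by exact: is_derive1_comp.
  have dE : is_derive x 1 (expR \o v) (expR (v x) * (- (- x ^- 2 *: 1))).
    exact: is_derive1_comp.
  apply: (is_derive_eq (is_deriveM dP dE)).
  rewrite /= !hornerE -![_ *: _]/(_ * _) /=.
  rewrite -[v x]/(- x^-1) -exprVn; ring.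
- rewrite flat_exp_le0//.
  (* The factor ['X^2], evaluated at [y^-1], turns the uniform bound into the bound [C * y ^+ 2]
     wanted by [is_derive_0_sqr]. *)
  have [C C0 PC] := poly_expRN_bounded ('X^2 * P).
  apply: (@is_derive_0_sqr _ C) => y.
  rewrite /flat_exp; case: ifPn => y0; last by rewrite normr0 mulr_ge0// sqr_ge0.
  rewrite -ler_pdivrMr ?exprn_gt0// -[X in _ / X]ger0_norm ?sqr_ge0//.
  rewrite -normfV -normrM.
  have := PC y^-1; rewrite invr_ge0 => /(_ (ltW y0)).
  by rewrite hornerM hornerXn exprVn -mulrA mulrC.
Unshelve. all: by end_near. Qed.

(* A class closed under derivation, hence made of infinitely differentiable
   functions. *)
Inductive smooth : (R -> R) -> Prop :=
| smooth_flat_exp P : smooth (flat_exp P)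
| smooth_cst (a : R) : smooth (cst a)
| smoothD f g : smooth f -> smooth g -> smooth (f + g)
| smoothM f g : smooth f -> smooth g -> smooth (f * g)
| smooth_affine f (a b : R) : smooth f -> smooth (fun x => f (a * x + b))
| smoothV f : (forall x, f x != 0) -> smooth f -> smooth (fun x => (f x)^-1).

Lemma is_derive_affine f (a b x df : R) : is_derive (a * x + b) 1 f df ->
  is_derive x 1 (fun y => f (a * y + b)) (df * a).
Proof.
move=> fd; apply: (@is_derive1_comp _ f (fun y => a * y + b)) => //.
have : is_derive x 1 ((a \*: (id : R -> R)) + cst b) (a *: 1 + 0).
  exact: is_deriveD.
by rewrite addr0 -[a *: 1]/(a * 1) mulr1.
Qed.

(** By induction, the derivative of each constructor is again expressed by constructors; iterating
    gives derivatives of every order. *)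
Lemma smooth_derive f : smooth f ->
  exists2 g, smooth g & forall x, is_derive x 1 f (g x).
Proof.
elim=> {f}.
- by move=> P; exists (flat_exp ('X^2 * (P - P^`()))) => [|x];
    [exact: smooth_flat_exp|exact: is_derive_flat_exp].
- by move=> a; exists (cst 0) => [|x]; [exact: smooth_cst|exact: is_derive_cst].
- move=> f g _ [f' sf ff'] _ [g' sg gg'].
  by exists (f' + g') => [|x]; [exact: smoothD|exact: is_deriveD].
- move=> f g sf [f' sf' ff'] sg [g' sg' gg'].
  exists (f * g' + g * f'); first by apply: smoothD; exact: smoothM.
  by move=> x; exact: is_deriveM.
- move=> f a b sf [f' sf' ff'].
  exists ((fun x => f' (a * x + b)) * cst a).
    by apply: smoothM; [exact: smooth_affine|exact: smooth_cst].
  by move=> x; exact: is_derive_affine.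
- move=> f f0 sf [f' sf' ff'].
  (* The derivative of [1 / f], spelled as a product so that it visibly stays in the class. *)
  exists (cst (-1) * f' * (fun x => (f x)^-1) * (fun x => (f x)^-1)).
    by repeat apply: smoothM; rewrite ?sf'//; (exact: smooth_cst || exact: smoothV).
  move=> x; apply: (is_derive_eq (is_deriveV (f0 x) (ff' x))).
  by rewrite /= -[RHS]/(-1 * f' x * _ * _) -[LHS]/(_ * _) -exprVn expr2; ring.
Qed.

Lemma is_derive_derive1 f g : (forall x, is_derive x 1 f (g x)) -> derive1 f = g.
Proof. by move=> fg; apply/funext => x; rewrite derive1E; apply: derive_val. Qed.

Lemma smooth_derive1n f n : smooth f -> smooth (derive1n n f).
Proof.
move=> sf; elim: n => // n IH; rewrite derive1nS.
by have [g sg /is_derive_derive1 ->] := smooth_derive IH.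
Qed.

Lemma smooth_derivable f x : smooth f -> derivable f x 1.
Proof. by move=> /smooth_derive[g _ fg]; have [] := fg x. Qed.

Lemma smooth_continuous f : smooth f -> continuous f.
Proof.
move=> sf x; apply: differentiable_continuous; apply/derivable1_diffP.
exact: smooth_derivable.
Qed.


Let flat : R -> R := flat_exp 1.

(** The usual transition function over the unit interval. Its denominator is positive, since [x] and
    [1 - x] are never both nonpositive. *)
Definition smooth_step x := flat x / (flat x + flat (1 - x)).

Let flat_ge0 x : 0 <= flat x.
Proof. by apply: flat_exp_ge0 => y; rewrite hornerE. Qed.

Let flat_gt0 x : 0 < x -> 0 < flat x.
Proof. by move=> x0; rewrite /flat /flat_exp x0 hornerE mul1r expR_gt0. Qed.

Let flat_denom_gt0 x : 0 < flat x + flat (1 - x).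
Proof.
have [x0|x0] := ltP 0 x; first by rewrite ltr_pwDl// flat_gt0.
by rewrite ltr_wpDl// flat_gt0// subr_gt0 (le_lt_trans x0).
Qed.

Lemma smooth_step_le0 x : x <= 0 -> smooth_step x = 0.
Proof. by move=> x0; rewrite /smooth_step /flat flat_exp_le0// mul0r. Qed.

Lemma smooth_step_ge1 x : 1 <= x -> smooth_step x = 1.
Proof.
move=> x1; rewrite /smooth_step [flat (1 - x)]flat_exp_le0 ?subr_le0// addr0 divff//.
by rewrite gt_eqF// flat_gt0// (lt_le_trans _ x1).
Qed.

Lemma smooth_step_ge0 x : 0 <= smooth_step x.
Proof. by rewrite divr_ge0// ltW. Qed.

Lemma smooth_step_le1 x : smooth_step x <= 1.
Proof. by rewrite ler_pdivrMr// mul1r lerDl. Qed.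

Let flat1E : (fun x => flat (1 - x)) = fun x => flat (-1 * x + 1).
Proof. by apply/funext => x; rewrite mulN1r addrC. Qed.

Let smooth_denom : smooth (fun x => flat x + flat (1 - x)).
Proof.
apply: (@smoothD _ (fun x => flat (1 - x))); first exact: smooth_flat_exp.
by rewrite flat1E; apply: smooth_affine; exact: smooth_flat_exp.
Qed.

Lemma smooth_smooth_step : smooth smooth_step.
Proof.
apply: smoothM; first exact: smooth_flat_exp.
by apply: smoothV => // x; rewrite gt_eqF.
Qed.

(** In the quotient rule the products of [flat x] with its own derivative cancel; from what remains
    the sign and the support of the derivative can be read off. *)
Lemma derive1_smooth_step x : derive1 smooth_step x =
  (flat_exp 'X^2 x * flat (1 - x) + flat x * flat_exp 'X^2 (1 - x)) /
  (flat x + flat (1 - x)) ^+ 2.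
Proof.
have dflat (y : R) : is_derive y 1 flat (flat_exp 'X^2 y).
  by have := is_derive_flat_exp 1 y; rewrite derivC subr0 mulr1.
have dflat1 : is_derive x 1 (fun x => flat (1 - x)) (- flat_exp 'X^2 (1 - x)).
  rewrite flat1E -[- flat_exp _ _]mulrN1; apply: is_derive_affine.
  by rewrite mulN1r addrC.
have dden := is_deriveD (dflat x) dflat1.
have den0 : (flat + (fun x => flat (1 - x))) x != 0.
  by rewrite gt_eqF//; exact: flat_denom_gt0.
have [_ dst] := is_deriveM (dflat x) (is_deriveV den0 dden).
rewrite derive1E; apply: etrans; first exact: dst.
rewrite /= -![_ *: _]/(_ * _) -[(flat + _) x]/(flat x + flat (1 - x)).
have := flat_denom_gt0 x.
move: (flat x) (flat (1 - x)) (flat_exp _ _) (flat_exp _ _) => a b c d ab.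
by field; rewrite gt_eqF.
Qed.

Lemma derive1_smooth_step_ge0 x : 0 <= derive1 smooth_step x.
Proof.
have ? y : 0 <= flat_exp ('X^2 : {poly R}) y.
  by apply: flat_exp_ge0 => z; rewrite hornerXn sqr_ge0.
by rewrite derive1_smooth_step divr_ge0// ?sqr_ge0// addr_ge0// mulr_ge0.
Qed.

Lemma derive1_smooth_step_eq0 x : (x <= 0) || (1 <= x) -> derive1 smooth_step x = 0.
Proof.
rewrite derive1_smooth_step /flat => /orP[x0|x1].
  by rewrite !(flat_exp_le0 _ x0)// !mul0r addr0 mul0r.
by rewrite !(@flat_exp_le0 _ (1 - x)) ?subr_le0// !mulr0 addr0 mul0r.
Qed.

(** A step from 0 to 1 across [[c, c + e]]. The argument is kept in the form [a * x + b] to match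
    [smooth_affine]. *)
Definition scaled_step (c e x : R) := smooth_step (e^-1 * x + - (c / e)).

(** The derivative of [scaled_step c e]: for positive [e], a mollifier of mass 1 living on
    [[c, c + e]]. *)
Definition scaled_bump (c e x : R) :=
  derive1 smooth_step (e^-1 * x + - (c / e)) * e^-1.

Lemma scaled_argE (c e x : R) : e^-1 * x + - (c / e) = (x - c) / e.
Proof. by rewrite mulrC mulrBl. Qed.

Lemma smooth_scaled_step c e : smooth (scaled_step c e).
Proof. exact: smooth_affine smooth_smooth_step. Qed.

Lemma is_derive_scaled_step c e x :
  is_derive x 1 (scaled_step c e) (scaled_bump c e x).
Proof.
apply: is_derive_affine; rewrite derive1E; apply: derivableP.
exact/smooth_derivable/smooth_smooth_step.
Qed.

Lemma smooth_scaled_bump c e : smooth (scaled_bump c e).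
Proof.
have <- := is_derive_derive1 (is_derive_scaled_step c e).
exact: (smooth_derive1n 1 (smooth_scaled_step c e)).
Qed.

Lemma scaled_step_le (c e x : R) : 0 < e -> x <= c -> scaled_step c e x = 0.
Proof.
move=> e0 xc; apply: smooth_step_le0.
by rewrite scaled_argE pmulr_lle0 ?invr_gt0// subr_le0.
Qed.

Lemma scaled_step_ge (c e x : R) : 0 < e -> c + e <= x -> scaled_step c e x = 1.
Proof.
move=> e0 xc; apply: smooth_step_ge1.
by rewrite scaled_argE ler_pdivlMr// mul1r lerBrDl.
Qed.

Lemma scaled_step_itv c e x : 0 <= scaled_step c e x <= 1.
Proof. by rewrite smooth_step_ge0 smooth_step_le1. Qed.

Lemma scaled_bump_ge0 c e x : 0 < e -> 0 <= scaled_bump c e x.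
Proof. by move=> e0; rewrite mulr_ge0 ?derive1_smooth_step_ge0// invr_ge0 ltW. Qed.

Lemma scaled_bump_eq0 (c e x : R) : 0 < e -> (x <= c) || (c + e <= x) ->
  scaled_bump c e x = 0.
Proof.
move=> e0 xce; rewrite /scaled_bump derive1_smooth_step_eq0 ?mul0r// scaled_argE.
by rewrite pmulr_lle0 ?invr_gt0// subr_le0 ler_pdivlMr// mul1r lerBrDl.
Qed.

End smooth_step.

(** * Weak second derivatives *)

Section weak_second_derivative.
Context {R : realType}.
Notation mu := (@lebesgue_measure R).
Implicit Types (f g y Y : R -> R) (T a b c e : R).

Lemma continuous_itv_integrable f a b : {within `[a, b], continuous f} ->
  mu.-integrable `[a, b] (EFin \o f).
Proof.
by move=> cf; apply: continuous_compact_integrable => //; exact: segment_compact.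
Qed.

Lemma continuous_derivable_oo_LRcontinuous f a b : a < b ->
  (forall x, derivable f x 1) -> derivable_oo_LRcontinuous f a b.
Proof.
move=> ab df; have cf : continuous f.
  by move=> x; apply: differentiable_continuous; exact/derivable1_diffP.
by split=> //; [exact/cvg_at_right_filter/cf|exact/cvg_at_left_filter/cf].
Qed.

Lemma Rintegral_scaled_bump T c e : 0 < e -> 0 <= c -> c + e <= T ->
  \int[mu]_(x in `[0, T]) scaled_bump c e x = 1.
Proof.
move=> e0 c0 ceT; have T0 : 0 < T by rewrite (lt_le_trans _ ceT)// ltr_wpDl.
rewrite /Rintegral (@continuous_FTC2 _ _ (scaled_step c e))//.
- by rewrite scaled_step_ge// scaled_step_le// -EFinB subr0.
- by apply: continuous_subspaceT; exact/smooth_continuous/smooth_scaled_bump.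
- apply: continuous_derivable_oo_LRcontinuous => // x.
  exact/smooth_derivable/smooth_scaled_step.
- by move=> x _; rewrite (is_derive_derive1 (is_derive_scaled_step c e)).
Qed.

Lemma within_continuousM f g (A : set R) :
  {within A, continuous f} -> {within A, continuous g} ->
  {within A, continuous (fun x => f x * g x)}.
Proof. by move=> cf cg x; apply: continuousM; [exact: cf|exact: cg]. Qed.

(** The integral is an average of [Y] over [[c, c + e]], as the bump is nonnegative, has mass 1 and
    vanishes elsewhere. *)
Lemma Rintegral_scaled_bump_near Y T c e L h :
  0 < e -> 0 <= c -> c + e <= T -> {within `[0, T], continuous Y} ->
  (forall x, c < x < c + e -> `|Y x - L| <= h) ->
  `|\int[mu]_(x in `[0, T]) (Y x * scaled_bump c e x) - L| <= h.
Proof.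
move=> e0 c0 ceT cY Yh.
have cD : {within `[0, T], continuous (scaled_bump c e)}.
  by apply: continuous_subspaceT; exact/smooth_continuous/smooth_scaled_bump.
have iD := continuous_itv_integrable cD.
have cYD := within_continuousM cY cD.
have iYD := continuous_itv_integrable cYD.
have cLD : {within `[0, T], continuous (fun x => L * scaled_bump c e x)}.
  by apply: (@within_continuousM (cst L)) => //;
    apply: continuous_subspaceT; exact: cst_continuous.
have iLD := continuous_itv_integrable cLD.
have D1 := Rintegral_scaled_bump e0 c0 ceT.
(* Mass 1 lets [L], and below [h], be written as an integral against the bump. *)
have -> : L = \int[mu]_(x in `[0, T]) (L * scaled_bump c e x).
  by rewrite RintegralZl// D1 mulr1.
rewrite -RintegralB//.
have chD : {within `[0, T], continuous (fun x => h * scaled_bump c e x)}.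
  by apply: (@within_continuousM (cst h)) => //;
    apply: continuous_subspaceT; exact: cst_continuous.
have idiff : mu.-integrable `[0, T]
    (EFin \o (fun x => Y x * scaled_bump c e x - L * scaled_bump c e x)).
  exact: (integrableB _ iYD iLD).
rewrite (le_trans (le_normr_Rintegral _ idiff))//.
have -> : h = \int[mu]_(x in `[0, T]) (h * scaled_bump c e x).
  by rewrite RintegralZl// D1 mulr1.
apply: le_Rintegral => //.
- exact: integrable_norm.
- exact: continuous_itv_integrable.
- move=> x _; have [xce|] := boolP (c < x < c + e).
    rewrite -mulrBl normrM (ger0_norm (scaled_bump_ge0 _ _ _))//.
    by rewrite ler_wpM2r ?scaled_bump_ge0// Yh.
  rewrite negb_and -!leNgt => xce.
  by rewrite scaled_bump_eq0// !mulr0 subrr normr0.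
Qed.

(** A smooth approximation of the indicator of [[a, b]], climbing on [[a, a + e]] and descending on
    [[b - e, b]]. The difference is written with [cst (-1)] because [smooth] has no constructor for
    opposites. *)
Definition plateau a b e : R -> R :=
  scaled_step a e + cst (-1) * scaled_step (b - e) e.

Lemma smooth_plateau a b e : smooth (plateau a b e).
Proof.
apply: smoothD; first exact: smooth_scaled_step.
by apply: smoothM; [exact: smooth_cst|exact: smooth_scaled_step].
Qed.

Lemma plateauE a b e x :
  plateau a b e x = scaled_step a e x - scaled_step (b - e) e x.
Proof. by rewrite -[LHS]/(_ + -1 * _) mulN1r. Qed.

Lemma plateau_out a b e x : 0 < e -> a + e <= b - e ->
  (x <= a) || (b <= x) -> plateau a b e x = 0.
Proof.
move=> e0 abe; rewrite plateauE => /orP[xa|bx].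
  by rewrite !scaled_step_le// ?subr0//; lra.
by rewrite !scaled_step_ge// ?subrr//; lra.
Qed.

Lemma plateau_in a b e x : 0 < e -> a + e <= x -> x <= b - e ->
  plateau a b e x = 1.
Proof.
by move=> e0 ax xb; rewrite plateauE scaled_step_ge// scaled_step_le// subr0.
Qed.

Lemma plateau_norm_le1 a b e x : `|plateau a b e x| <= 1.
Proof.
have := scaled_step_itv a e x; have := scaled_step_itv (b - e) e x.
by rewrite plateauE ler_norml; lra.
Qed.

Lemma test_function_plateau T a b e : 0 < a -> b < T -> 0 < e ->
  a + e <= b - e -> test_function T (plateau a b e).
Proof.
move=> a0 bT e0 abe.
have suppab : closure [set x | plateau a b e x != 0] `<=` `[a, b].
  have /closure_id -> : closed `[a, b]%classic by exact: itv_closed.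
  apply: closure_subset => x /= phix; rewrite in_itv/=.
  apply: contra_neqT phix; rewrite negb_and -!ltNge => xab.
  by apply: plateau_out => //; case/orP: xab => /ltW ->; rewrite ?orbT.
split.
- move=> n x; apply: smooth_derivable; apply: smooth_derive1n; exact: smooth_plateau.
- apply: (subclosed_compact _ (@segment_compact R a b)) => //.
  exact: closed_closure.
- apply: (subset_trans suppab) => x /=; rewrite !in_itv/= => /andP[ax xb].
  by rewrite (lt_le_trans a0)//= (le_lt_trans xb).
Qed.

(** The plateau is the test function. One integration by parts moves one of its two derivatives back
    onto [y], and its remaining derivative is a difference of two bumps. *)
Lemma weak_derivative2_plateau T y Y g a b e :
  derivable_oo_LRcontinuous y 0 T -> {within `[0, T], continuous Y} ->
  {in `]0, T[, derive1 y =1 Y} -> is_weak_derivative T 2 y g ->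
  0 < a -> b < T -> 0 < e -> a + e <= b - e ->
  \int[mu]_(x in `]0, T[) (g x * plateau a b e x) =
  \int[mu]_(x in `[0, T]) (Y x * scaled_bump (b - e) e x) -
  \int[mu]_(x in `[0, T]) (Y x * scaled_bump a e x).
Proof.
move=> dy cY yY [_ _ wg] a0 bT e0 abe.
have T0 : 0 < T by lra.
have := wg _ (test_function_plateau a0 bT e0 abe).
rewrite sqrrN expr1n mul1r => <-.
pose D : R -> R := scaled_bump a e + cst (-1) * scaled_bump (b - e) e.
have sD : smooth D.
  apply: smoothD; first exact: smooth_scaled_bump.
  by apply: smoothM; [exact: smooth_cst|exact: smooth_scaled_bump].
have DE x : D x = scaled_bump a e x - scaled_bump (b - e) e x.
  by rewrite -[LHS]/(_ + -1 * _) mulN1r.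
have dphi : derive1 (plateau a b e) = D.
  apply: is_derive_derive1 => x; have d1 := is_derive_scaled_step a e x.
  have d2 := is_derive_scaled_step (b - e) e x.
  have d3 : is_derive x 1 (cst (-1) : R -> R) 0 by exact: is_derive_cst.
  apply: (is_derive_eq (is_deriveD d1 (is_deriveM d3 d2))).
  by rewrite DE scaler0 addr0 -[_ *: _]/(-1 * _) mulN1r.
have cy := derivable_oo_LRcontinuous_within dy.
have sD' : smooth (derive1 D) by exact: (smooth_derive1n 1 sD).
have cD : {within `[0, T], continuous D}.
  by apply: continuous_subspaceT; exact/smooth_continuous.
have cD' : {within `[0, T], continuous (derive1 D)}.
  by apply: continuous_subspaceT; exact/smooth_continuous.
have iyD := continuous_itv_integrable (within_continuousM cy cD').
have s1 : `]0, T[%classic `<=` (`[0, T]%classic : set R).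
  by apply: subset_itvW.
have s2 : `]0, T]%classic `<=` (`[0, T]%classic : set R).
  by apply: subset_itv_oc_cc.
rewrite derive1nS derive1n1 dphi.
(* Integration by parts is done on the closed interval; the two added endpoints are a null set. *)
rewrite Rintegral_itv_bndo_bndc; last by apply: integrableS iyD.
rewrite Rintegral_itv_obnd_cbnd; last by apply: integrableS iyD.
have dD : derivable_oo_LRcontinuous D 0 T.
  apply: (continuous_derivable_oo_LRcontinuous T0) => x.
  exact: smooth_derivable sD.
rewrite (@Rintegration_by_parts _ y D Y)//.
(* The boundary terms vanish, since both bumps live inside [[a, b]] with [0 < a] and [b < T]. *)
have D0 : D 0 = 0 by rewrite DE !scaled_bump_eq0 ?subrr//; apply/orP; left; lra.
have DT : D T = 0 by rewrite DE !scaled_bump_eq0 ?subrr//; apply/orP; right; lra.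
have cb c : {within `[0, T], continuous (scaled_bump c e)}.
  by apply: continuous_subspaceT; exact/smooth_continuous/smooth_scaled_bump.
have iY c := continuous_itv_integrable (within_continuousM cY (cb c)).
rewrite D0 DT !mulr0 subrr sub0r -RintegralB//.
rewrite -mulN1r -RintegralZl//; last first.
  exact: continuous_itv_integrable (within_continuousM cY cD).
by apply: eq_Rintegral => x _; rewrite DE; ring.
Qed.

End weak_second_derivative.

(** * The first derivative as a primitive of the weak second derivative *)

Section FTC_weak.
Context {R : realType}.
Notation mu := (@lebesgue_measure R).
Implicit Types (f g y Y : R -> R) (T a b c e : R).

Lemma locally_integrable_itv g T a b : locally_integrable `]0, T[ g ->
  0 < a -> b < T -> mu.-integrable `[a, b] (EFin \o g).
Proof.
move=> [mg _ lg] a0 bT.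
have sub : `[a, b]%classic `<=` (`]0, T[%classic : set R).
  move=> x /=; rewrite !in_itv/= => /andP[ax xb].
  by rewrite (lt_le_trans a0)//= (le_lt_trans xb).
apply/integrableP; split.
  by apply/measurable_EFinP; apply: measurable_funS mg.
by apply: lg => //; exact: segment_compact.
Qed.

(** The supports shrink to [d] while containing it, so the averages tend to [Y d] by continuity. The
    position of [d] in the support is left free: it is the left end for one flank of the plateau and
    the right end for the other. *)
Lemma cvg_Rintegral_scaled_bump Y T d (c e : R^nat) :
  {within `[0, T], continuous Y} -> 0 < d < T ->
  (forall n, [/\ 0 < e n, 0 <= c n, c n + e n <= T & c n <= d <= c n + e n]) ->
  e @ \oo --> 0 ->
  \int[mu]_(x in `[0, T]) (Y x * scaled_bump (c n) (e n) x) @[n --> \oo] --> Y d.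
Proof.
move=> cY /andP[d0 dT] ce e0.
have cYd : {for d, continuous Y}.
  have [+ _ _] := (continuous_within_itvP _ (lt_trans d0 dT)).1 cY.
  by apply; rewrite in_itv/= d0.
apply/cvgrPdistC_le => h h0.
have Yd : \forall x \near d, `|Y x - Y d| <= h.
  by move/cvgrPdistC_le : cYd; exact.
have /nbhs_ballP[r /= r0 Yr] := Yd.
near=> n; have [en0 cn0 cnT /andP[cd dc]] := ce n.
apply: Rintegral_scaled_bump_near => // x /andP[cx xc].
apply: Yr; rewrite -ball_normE/= ltr_norml.
have : `|e n| < r by near: n; move: e0 => /cvgr0Pnorm_lt; apply.
by rewrite ger0_norm ?ltW//; lra.
Unshelve. all: by end_near. Qed.

(** Limit of [weak_derivative2_plateau] as the flanks narrow: the bump integrals converge by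
    continuity of [Y], the integral of [g] against the plateau by dominated convergence. The points
    [a] and [b] are interior because [g] is only locally integrable. *)
Lemma weak_derivative2_FTC T y Y g a b :
  derivable_oo_LRcontinuous y 0 T -> {within `[0, T], continuous Y} ->
  {in `]0, T[, derive1 y =1 Y} -> is_weak_derivative T 2 y g ->
  0 < a -> a < b -> b < T ->
  Y b - Y a = \int[mu]_(x in `]a, b[) g x.
Proof.
move=> dy cY yY wg a0 ab bT.
(* The half keeps the two flanks from overlapping for every [n]. *)
pose e n : R := (b - a) / 2 * (n.+1%:R)^-1.
have e0 n : 0 < e n by rewrite mulr_gt0 ?invr_gt0// divr_gt0 ?subr_gt0.
have ele n : e n <= (b - a) / 2.
  by rewrite ler_piMr ?invf_le1 ?ler1n// divr_ge0// subr_ge0 ltW.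
have cvge : e @ \oo --> 0.
  by rewrite -(mulr0 ((b - a) / 2)); apply: cvgMr; exact: cvg_harmonic.
have eab n : a + e n <= b - e n by have := ele n; lra.
have wgn n := weak_derivative2_plateau dy cY yY wg a0 bT (e0 n) (eab n).
have cvg1 : \int[mu]_(x in `]0, T[) (g x * plateau a b (e n) x) @[n --> \oo] -->
    Y b - Y a.
  under eq_cvg do rewrite wgn.
  apply: cvgB; apply: cvg_Rintegral_scaled_bump => //; try by lra.
  - by move=> n; have := e0 n; have := ele n; split => //; lra.
  - by move=> n; have := e0 n; have := ele n; split => //; lra.
have [_ lg _] := wg.
have ig : mu.-integrable `]a, b[ (EFin \o g).
  by apply: integrableS (locally_integrable_itv lg a0 bT) => //; exact: subset_itvW.
have sub : `]a, b[%classic `<=` (`]0, T[%classic : set R).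
  move=> x /=; rewrite !in_itv/= => /andP[ax xb].
  by rewrite (lt_trans a0)//= (lt_trans xb).
have igr : mu.-integrable `]0, T[ ((EFin \o g) \_ `]a, b[).
  by apply/integrable_restrict => //; rewrite setIidr.
(* The dominating function is [|g|] cut off to []a, b[]: the plateau is at most 1 in modulus and
   vanishes outside. *)
have [] := @dominated_convergence _ _ _ mu `]0, T[%classic (measurable_itv _)
  (fun n x => (g x * plateau a b (e n) x)%:E) ((EFin \o g) \_ `]a, b[)
  (fun x => `|((EFin \o g) \_ `]a, b[) x|%E).
- move=> n; apply/measurable_EFinP; apply: measurable_funM.
    by have [] := lg.
  apply: measurable_funTS; apply: continuous_measurable_fun.
  exact/smooth_continuous/smooth_plateau.
- by case/integrableP : igr.
- apply: aeW => x _; rewrite patchE; case: ifPn => xab.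
    move: xab; rewrite inE/= in_itv/= => /andP[ax xb].
    (* Once [e n] is below the distance from [x] to both ends, the plateau equals 1 at [x]. *)
    have xab0 : 0 < Num.min (x - a) (b - x) by rewrite lt_min !subr_gt0 ax.
    apply: cvg_near_cst; near=> n.
    have : `|e n| < Num.min (x - a) (b - x).
      by near: n; move: cvge => /cvgr0Pnorm_lt; apply.
    rewrite ger0_norm ?ltW// lt_min => /andP[h1 h2].
    by rewrite plateau_in ?mulr1//; lra.
  apply: cvg_near_cst; near=> n.
  move: xab; rewrite notin_setE/= in_itv/= => /negP; rewrite negb_and -!leNgt => xab.
  by rewrite plateau_out ?mulr0.
- exact: integrable_abse.
- apply: aeW => x n _; rewrite patchE; case: ifPn => xab.
    by rewrite lee_fin normrM ler_piMr// plateau_norm_le1.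
  move: xab; rewrite notin_setE/= in_itv/= => /negP; rewrite negb_and -!leNgt => xab.
  by rewrite plateau_out ?mulr0 ?abse0 ?normr0.
move=> _ _ cvg2.
have cvg3 : \int[mu]_(x in `]0, T[) (g x * plateau a b (e n) x) @[n --> \oo] -->
    \int[mu]_(x in `]a, b[) g x.
  apply: fine_cvg; rewrite fineK; last exact: integrable_fin_num.
  by move: cvg2; rewrite -integral_mkcondr setIidr.
exact: cvg_unique cvg1 cvg3.
Unshelve. all: by end_near. Qed.

End FTC_weak.

(** * Integrals of powers and the Gamma function *)

Section improper_integrals.
Context {R : realType}.
Notation mu := (@lebesgue_measure R).
Implicit Types (f F : R -> R) (a b c u v t x theta : R).

(** An exhaustion by segments; [n.+3] keeps even the one for [n = 0] nondegenerate. *)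
Lemma bigcup_itvcc_oo a b : a < b ->
  \bigcup_n `[a + (b - a) / n.+3%:R, b - (b - a) / n.+3%:R]%classic =
  `]a, b[%classic :> set R.
Proof.
move=> ab; have ba : 0 < b - a by rewrite subr_gt0.
apply/seteqP; split=> x /=.
  move=> [n _] /=; rewrite !in_itv/= => /andP[ax xb].
  have : 0 < (b - a) / n.+3%:R by rewrite divr_gt0.
  by move: ax xb; set r := _ / _ => *; apply/andP; split; lra.
rewrite in_itv/= => /andP[ax xb].
have m0 : 0 < Num.min (x - a) (b - x) by rewrite lt_min !subr_gt0 ax.
have [n _ /(_ n (leqnn n))] :=
  near_infty_natSinv_lt (PosNum (divr_gt0 m0 ba)).
rewrite /= ltr_pdivlMr// mulrC lt_min => /andP[nm1 nm2].
exists n => //=; rewrite in_itv/=.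
have : (b - a) / n.+3%:R <= (b - a) / n.+1%:R.
  by rewrite ler_pM2l// lef_pV2 ?posrE// ler_nat; do 2 apply: leqW.
by move: nm1 nm2; set r := _ / n.+1%:R; set r' := _ / _ => *; apply/andP; split; lra.
Qed.

(** Allows [f] to blow up at the ends, as negative powers do: the formula holds on each segment of
    the exhaustion, the integrals converge monotonically since [f] is nonnegative, and [F] is
    continuous up to the ends. *)
Lemma ge0_continuous_FTC2oo f F a b : a < b ->
  (forall x, a < x < b -> 0 <= f x) -> {in `]a, b[, continuous f} ->
  derivable_oo_LRcontinuous F a b -> {in `]a, b[, derive1 F =1 f} ->
  (\int[mu]_(x in `]a, b[) (f x)%:E = (F b - F a)%:E)%E.
Proof.
move=> ab f0 cf dF Ff; have ba : 0 < b - a by rewrite subr_gt0.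
pose e n : R := (b - a) / n.+3%:R.
have e0 n : 0 < e n by rewrite divr_gt0.
have ele n : e n <= (b - a) / 3 by rewrite ler_pM2l// lef_pV2 ?posrE// ler_nat.
have elt n : a + e n < b - e n by have := ele n; lra.
pose A n : set R := `[a + e n, b - e n]%classic.
have Aoo n : A n `<=` `]a, b[%classic.
  by rewrite -(bigcup_itvcc_oo ab); exact: bigcup_sup.
have ecvg : e n @[n --> \oo] --> 0.
  rewrite -(mulr0 (b - a)); apply: cvgMr.
  by have := @cvg_harmonic R; rewrite -(cvg_shiftn 2); under eq_fun do rewrite addn2.
have cvgA : (\int[mu]_(x in A n) (f x)%:E @[n --> \oo] -->
    \int[mu]_(x in `]a, b[) (f x)%:E)%E.
  rewrite -(bigcup_itvcc_oo ab); apply: ge0_nondecreasing_set_cvg_integral => //.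
  - apply/nondecreasing_seqP => n; rewrite subsetEset => x /=; rewrite /A /= !in_itv/=.
    have : e n.+1 <= e n by rewrite ler_pM2l// lef_pV2 ?posrE// ler_nat.
    by move=> h /andP[h1 h2]; apply/andP; split; lra.
  - by move=> n; exact: measurable_itv.
  - move=> n; apply/measurable_EFinP; apply: (measurable_funS _ (Aoo n)) => //.
    apply: open_continuous_measurable_fun => // x; rewrite inE; exact: cf.
  - move=> n x /(Aoo n) /=; rewrite in_itv/= lee_fin; exact: f0.
have cF := derivable_oo_LRcontinuous_within dF.
have AE n : (\int[mu]_(x in A n) (f x)%:E = (F (b - e n) - F (a + e n))%:E)%E.
  have sub : `[a + e n, b - e n] `<=` `[a, b].
    by apply: subset_itv; rewrite bnd_simp; have := e0 n; lra.
  rewrite EFinB; apply: continuous_FTC2 => //.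
  - apply: continuous_in_subspaceT => x; rewrite inE => /(Aoo n); exact: cf.
  - exact: derivable_oo_continuousW dF.
  - move=> x xA; apply: Ff.
    have en := e0 n; move: xA; rewrite !in_itv/= => /andP[h1 h2].
    by apply/andP; split; lra.
have cvgF : (F (b - e n) - F (a + e n))%:E @[n --> \oo] --> (F b - F a)%:E.
  apply: cvg_EFin; first exact: nearW.
  have [_ Fa Fb] := dF.
  apply: cvgB.
  - apply: (cvg_at_leftP _ _ _).1 Fb _ _; split; first by move=> n; have := e0 n; lra.
    by rewrite -[X in _ --> X]subr0; apply: cvgB => //; exact: cvg_cst.
  - apply: (cvg_at_rightP _ _ _).1 Fa _ _; split; first by move=> n; have := e0 n; lra.
    by rewrite -[X in _ --> X]addr0; apply: cvgD => //; exact: cvg_cst.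
move: cvgA; under eq_cvg do rewrite AE; move=> cvgA.
exact: cvg_unique cvgA cvgF.
Qed.


Lemma cvg_powR_at_right0 theta : 0 < theta ->
  t `^ theta @[t --> (0 : R)^'+] --> (0 : R) `^ theta.
Proof. by move=> t0; rewrite powR0 ?gt_eqF//; exact: powR_cvg0. Qed.

Lemma continuous_powR theta x : 0 < x -> {for x, continuous (fun t => t `^ theta)}.
Proof.
move=> x0; apply: differentiable_continuous; apply/derivable1_diffP.
by apply: derivable_powR; rewrite in_itv/= x0.
Qed.

Lemma cvg_powR_at_right theta x : 0 < theta -> 0 <= x ->
  t `^ theta @[t --> x^'+] --> x `^ theta.
Proof.
move=> t0; rewrite le_eqVlt => /predU1P[<-|x0]; first exact: cvg_powR_at_right0.
by apply: cvg_at_right_filter; exact: continuous_powR.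
Qed.

(** Reflection swaps one-sided neighbourhoods; this carries the limit of a power at its origin over
    to the reflected power. *)
Lemma cvg_subl_at_left c b : (c - s) @[s --> b^'-] --> (c - b)^'+.
Proof.
move=> A [r /= r0 rA].
have : \forall s \near b^'-, A (c - s).
  near=> s; apply: rA => /=.
    rewrite opprB addrC addrA subrK distrC gtr0_norm; last by rewrite subr_gt0.
    by near: s; exact: nbhs_left_ltBl.
  by rewrite ltrD2l ltrN2.
by [].
Unshelve. all: by end_near. Qed.

Lemma integral_powR_oo theta u v : 0 < theta -> 0 <= u -> u < v ->
  (\int[mu]_(t in `]u, v[) (t `^ (theta - 1))%:E =
   ((v `^ theta - u `^ theta) / theta)%:E)%E.
Proof.
move=> t0 u0 uv.
have dP (x : R) : 0 < x ->
    is_derive x 1 (fun t => theta^-1 * t `^ theta) (x `^ (theta - 1)).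
  move=> x0; have := is_deriveZ theta^-1 (is_derive1_powR theta x0).
  by rewrite -[_ *: (_ * _)]/(_ * (_ * _)) mulKf ?gt_eqF.
rewrite (@ge0_continuous_FTC2oo _ (fun t => theta^-1 * t `^ theta))//.
- by rewrite -mulrBr mulrC.
- by move=> x _; exact: powR_ge0.
- move=> x; rewrite in_itv/= => /andP[ux _].
  by apply: continuous_powR; exact: le_lt_trans ux.
- split.
  + by move=> x; rewrite in_itv/= => /andP[ux _]; have [] := dP x (le_lt_trans u0 ux).
  + by apply: cvgMr; exact: cvg_powR_at_right.
  + apply: cvgMr; apply: cvg_at_left_filter.
    by apply: continuous_powR; exact: le_lt_trans uv.
- move=> x; rewrite in_itv/= => /andP[ux _].
  by rewrite derive1E; have [_ ->] := dP x (le_lt_trans u0 ux).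
Qed.

(** With [theta = 1 - alpha] this integrates the Caputo kernel; [b = c], where the kernel is
    singular, is the case of the last cell. *)
Lemma integral_powR_subl_oo theta a b c : 0 < theta -> a < b -> b <= c ->
  (\int[mu]_(t in `]a, b[) ((c - t) `^ (theta - 1))%:E =
   (((c - a) `^ theta - (c - b) `^ theta) / theta)%:E)%E.
Proof.
move=> t0 ab bc.
have dP (x : R) : x < b -> is_derive x 1 (fun t => - theta^-1 * (c - t) `^ theta)
    ((c - x) `^ (theta - 1)).
  move=> xb; have cx : 0 < c - x by rewrite subr_gt0 (lt_le_trans xb).
  have d1 : is_derive x 1 (fun t => c - t) (-1).
    have := is_deriveB (is_derive_cst c x 1) (is_derive_id x (1 : R)).
    by rewrite sub0r.
  have := is_deriveZ (- theta^-1)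
    (@is_derive1_comp _ _ (fun t => c - t) _ _ _ (is_derive1_powR theta cx) d1).
  by rewrite mulrN1 scalerN scaleNr opprK -[_ *: (_ * _)]/(_ * (_ * _)) mulKf ?gt_eqF.
rewrite (@ge0_continuous_FTC2oo _ (fun t => - theta^-1 * (c - t) `^ theta))//.
- by rewrite !mulNr opprK addrC -mulrBr mulrC.
- by move=> x _; exact: powR_ge0.
- move=> x; rewrite in_itv/= => /andP[_ xb].
  have cx : 0 < c - x by rewrite subr_gt0 (lt_le_trans xb).
  apply: (@continuous_comp _ _ _ (fun t => c - t) (fun t => t `^ (theta - 1))).
    by apply: cvgB; [exact: cvg_cst|exact: cvg_id].
  exact: continuous_powR.
- split.
  + by move=> x; rewrite in_itv/= => /andP[_ xb]; have [] := dP x xb.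
  + have [/derivable1_diffP/differentiable_continuous ca _] := dP a ab.
    exact: cvg_at_right_filter ca.
  + apply: cvgMr; apply: (@cvg_comp _ _ _ (fun t => c - t) (fun t => t `^ theta) _ _ _
      (@cvg_subl_at_left c b)).
    by apply: cvg_powR_at_right => //; rewrite subr_ge0.
- move=> x; rewrite in_itv/= => /andP[_ xb].
  by rewrite derive1E; have [_ ->] := dP x xb.
Qed.

(** The fractions [u / v] and [(v - u) / v] add up to 1, and raising a number of the unit interval
    to the power [theta] can only increase it. *)
Lemma powR_subadditive theta u v : 0 < theta <= 1 -> 0 <= u -> u <= v ->
  v `^ theta - u `^ theta <= (v - u) `^ theta.
Proof.
move=> /andP[t0 t1] u0 uv; rewrite lerBlDr.
have h x : 0 <= x <= 1 -> x <= x `^ theta.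
  move=> /andP[]; rewrite le_eqVlt => /predU1P[<- _|x0 x1].
    exact: powR_ge0.
  by apply: ger1_powR => //; rewrite x0.
have [v0|v0] := leP v 0.
  have -> : v = 0 by lra.
  by rewrite powR0 ?gt_eqF// addr_ge0// powR_ge0.
have -> : v `^ theta = v `^ theta * ((v - u) / v) + v `^ theta * (u / v).
  by rewrite -mulrDr -mulrDl subrK divff ?gt_eqF// mulr1.
have part x : 0 <= x <= v -> v `^ theta * (x / v) <= x `^ theta.
  move=> /andP[x0 xv]; rewrite -[leRHS](_ : v `^ theta * (x / v) `^ theta = _).
    rewrite ler_wpM2l ?powR_ge0// h// divr_ge0 ?(ltW v0)//=.
    by rewrite ler_pdivrMr// mul1r.
  by rewrite -powRM ?divr_ge0 ?(ltW v0)// mulrCA divff ?gt_eqF// mulr1.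
by apply: lerD; apply: part; lra.
Qed.

End improper_integrals.

(** * The functional equation of the Gamma function *)

Section Gamma_recurrence.
Context {R : realType}.
Notation mu := (@lebesgue_measure R).
Implicit Types (x b : R).

Lemma bigcup_itvcc_0y :
  \bigcup_n `[(n.+2%:R)^-1, n.+2%:R]%classic = `]0, +oo[%classic :> set R.
Proof.
apply/seteqP; split=> x /=.
  by move=> [n _] /=; rewrite !in_itv/= andbT => /andP[nx _]; apply: lt_le_trans nx.
rewrite in_itv/= andbT => x0.
have m0 : 0 < Num.max x x^-1 by rewrite lt_max x0.
exists (Num.bound (Num.max x x^-1)) => //=; rewrite in_itv/=.
have := archi_boundP (ltW m0); rewrite gt_max => /andP[h1 h2].
have bS : (Num.bound (Num.max x x^-1))%:R <= (Num.bound (Num.max x x^-1)).+2%:R :> R.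
  by rewrite ler_nat; do 2 apply: leqW.
rewrite -[X in _ <= X <= _]invrK lef_pV2 ?posrE ?invr_gt0// invrK.
by rewrite !(le_trans _ bS)// ltW.
Qed.

(** The exponent is rounded up to an integer [k]. The power [k.+1] times the exponential is still
    bounded, which leaves a bound [C / n.+2]. *)
Lemma cvg_powR_expRN x : 0 < x ->
  (n.+2%:R `^ x * expR (- n.+2%:R)) @[n --> \oo] --> (0 : R).
Proof.
move=> x0; have /ltW := archi_boundP (ltW x0); move: (Num.bound x) => k xk.
have [C C0 PC] := @poly_expRN_bounded R 'X^(k.+1).
have cvgC : C * (n.+2%:R)^-1 @[n --> \oo] --> (0 : R).
  rewrite -(mulr0 C); apply: cvgMr.
  by have := @cvg_harmonic R; rewrite -(cvg_shiftn 1); under eq_fun do rewrite addn1.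
apply: (squeeze_cvgr _ (cvg_cst 0) cvgC); near=> n.
rewrite mulr_ge0 ?powR_ge0 ?expR_ge0//= ler_pdivlMr//.
have := PC n.+2%:R (ler0n _ _); rewrite hornerXn.
apply: le_trans; rewrite ger0_norm; last by rewrite mulr_ge0 ?expR_ge0// exprn_ge0.
rewrite mulrAC ler_wpM2r ?expR_ge0// exprSr ler_wpM2r// -powR_mulrn//.
by apply: ler_powR => //; rewrite ler1n.
Unshelve. all: by end_near. Qed.

(* No finiteness is needed: if the integrals are infinite, both sides are the junk
   value 0. *)
Lemma GammaS x : 0 < x -> Gamma (x + 1) = x * Gamma x.
Proof.
move=> x0; rewrite /Gamma addrK.
(* Integration by parts is done on segments away from 0 and infinity, and the limit is taken
   afterwards. The shift by 2 gives [a n < b n] also for [n = 0]. *)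
pose a n : R := (n.+2%:R)^-1; pose b n : R := n.+2%:R.
pose A n : set R := `[a n, b n]%classic.
have a0 n : 0 < a n by rewrite /a invr_gt0 ltr0n.
have ab n : a n < b n.
  by apply: (@lt_trans _ _ 1); rewrite ?invf_lt1 // ltr1n.
have Asub n : A n `<=` `]0, +oo[%classic.
  by rewrite -bigcup_itvcc_0y; exact: bigcup_sup.
have cpow (z t : R) : 0 < t -> {for t, continuous (fun t => t `^ z * expR (- t))}.
  move=> t0; apply: cvgM; first exact: continuous_powR.
  apply: (@continuous_comp _ _ _ (fun t : R => - t) expR); first exact: opp_continuous.
  exact: continuous_expR.
have cvgA z : (\int[mu]_(t in A n) (t `^ z * expR (- t))%:E @[n --> \oo] -->
    \int[mu]_(t in `]0%R, +oo[) (t `^ z * expR (- t))%:E)%E.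
  rewrite -bigcup_itvcc_0y; apply: ge0_nondecreasing_set_cvg_integral => //.
  - apply/nondecreasing_seqP => n; rewrite subsetEset; apply: subset_itv.
      by rewrite bnd_simp lef_pV2 ?posrE// ler_nat.
    by rewrite bnd_simp ler_nat.
  - by move=> n; exact: measurable_itv.
  - move=> n; apply/measurable_EFinP; apply: (measurable_funS _ (Asub n)) => //.
    apply: open_continuous_measurable_fun => // t; rewrite inE/= in_itv/= andbT.
    exact: cpow.
  - by move=> n t _; rewrite lee_fin mulr_ge0 ?powR_ge0 ?expR_ge0.
pose B n : R := a n `^ x * expR (- a n) - b n `^ x * expR (- b n).
have AE n : (\int[mu]_(t in A n) (t `^ x * expR (- t))%:E =
    (B n)%:E + x%:E * \int[mu]_(t in A n) (t `^ (x - 1) * expR (- t))%:E)%E.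
  have At t : A n t -> 0 < t by move=> /(Asub n) /=; rewrite in_itv/= andbT.
  have dE (t : R) : is_derive t 1 (fun t => - expR (- t)) (expR (- t)).
    have d1 : is_derive t 1 (fun t : R => - t) (-1) by exact: is_deriveNid.
    have := is_deriveN
      (@is_derive1_comp _ _ (fun t => - t) _ _ _ (is_derive_expR (- t)) d1).
    by rewrite mulrN1 opprK.
  have cA (z : R) : {within A n, continuous (fun t => t `^ z)}.
    apply: continuous_in_subspaceT => t; rewrite inE => /At; exact: continuous_powR.
  have cE : {within A n, continuous (fun t => expR (- t))}.
    apply: continuous_subspaceT => t.
    apply: (@continuous_comp _ _ _ (fun t : R => - t) expR); first exact: opp_continuous.
    exact: continuous_expR.
  rewrite (@integration_by_parts _ (fun t => t `^ x) (fun t => - expR (- t))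
    (fun t => x * t `^ (x - 1)))//.
  - rewrite (_ : _ - _ = B n); last by rewrite /B; ring.
    rewrite [X in (_ - X)%E](_ : _ =
      (- x)%:E * \int[mu]_(t in A n) (t `^ (x - 1) * expR (- t))%:E)%E.
      by rewrite EFinN mulNe oppeK.
    have mA : measurable (A n) by exact: measurable_itv.
    rewrite -integralZl//; last first.
      exact: continuous_itv_integrable (within_continuousM (cA (x - 1)) cE).
    by apply: eq_integral => t _; rewrite -EFinM mulrN mulNr mulrA.
  - apply: (@within_continuousM _ (cst x)); last exact: cA.
    by apply: continuous_subspaceT; exact: cst_continuous.
  - split.
    + move=> t; rewrite in_itv/= => /andP[at0 _].
      by apply: derivable_powR; rewrite in_itv/= andbT (lt_trans _ at0).
    + by apply: cvg_at_right_filter; exact: continuous_powR.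
    + apply: cvg_at_left_filter; apply: continuous_powR; exact: lt_trans (ab n).
  - move=> t; rewrite in_itv/= => /andP[at0 _].
    by rewrite powR_derive1// in_itv/= andbT (lt_trans _ at0).
  - by apply: continuous_derivable_oo_LRcontinuous => // t; have [] := dE t.
  - by move=> t _; rewrite derive1E; have [_ ->] := dE t.
(* At the lower end the power tends to 0 because [x] is positive; at the upper end the exponential
   wins. *)
have B0 : B n @[n --> \oo] --> (0 : R).
  rewrite -[X in _ --> X]subr0; apply: cvgB; last exact: cvg_powR_expRN.
  have : a n `^ x @[n --> \oo] --> (0 : R).
    apply: (cvg_at_rightP _ _ _).1 (powR_cvg0 x0) _ _; split => //.
    by have := @cvg_harmonic R; rewrite -(cvg_shiftn 1); under eq_fun do rewrite addn1.
  apply: squeeze_cvgr; last exact: cvg_cst.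
  near=> n; rewrite mulr_ge0 ?powR_ge0 ?expR_ge0//=.
  by rewrite ler_piMr ?powR_ge0// expR_le1 oppr_le0 ltW.
rewrite /Rintegral.
set U := (\int[_]_(t in _) (_ `^ x * _)%:E)%E.
set V := (\int[_]_(t in _) _)%E.
(* The limits are compared in the extended reals, where [V] may still be infinite. *)
suff -> : U = (x%:E * V)%E.
  by case: V => [r| |]//; rewrite ?gt0_muley ?gt0_muleNy ?lte_fin//= mulr0.
have cvg2 : ((B n)%:E + x%:E * \int[mu]_(t in A n) (t `^ (x - 1) * expR (- t))%:E)%E
    @[n --> \oo] --> (x%:E * V)%E.
  rewrite -[X in _ --> X]add0e; apply: cvgeD => //.
  - by apply: cvg_EFin; [exact: nearW|exact: B0].
  - by apply: cvgeZl => //; exact: cvgA.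
have := cvgA x; under eq_cvg do rewrite AE.
by move=> cvg1; exact: cvg_unique cvg1 cvg2.
Unshelve. all: by end_near. Qed.

End Gamma_recurrence.

(** * Oscillation of the derivative *)

Section weighted_hoelder.
Context {R : realType}.
Notation mu := (@lebesgue_measure R).
Implicit Types (g y Y w : R -> R) (T p m u v : R).

(* Hoelder's inequality for [|g| t^(m/p)] and [t^(-m/p)]. *)
Lemma le_integral_norm_weighted g T p m u v : 1 < p ->
  measurable_fun `]0, T[ g -> 0 <= u -> v <= T ->
  (\int[mu]_(t in `]u, v[) `|g t|%:E <=
   (\int[mu]_(t in `]0%R, T[) (`|g t| `^ p * t `^ m)%R%:E) `^ (p^-1)%R *
   (\int[mu]_(t in `]u, v[) (t `^ (- (m / (p - 1))))%R%:E) `^ (1 - p^-1)%R)%E.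
Proof.
move=> p1 mg u0 vT; have p0 : 0 < p by lra.
have sub : `]u, v[%classic `<=` (`]0, T[%classic : set R).
  move=> x /=; rewrite !in_itv/= => /andP[ux xv].
  by rewrite (le_lt_trans u0)//= (lt_le_trans xv).
(* Hoelder's inequality is applied on the whole line, so both factors are extended by zero. *)
pose f1 : R -> R := (fun t => `|g t| * t `^ (m / p)) \_ `]u, v[.
pose f2 : R -> R := (fun t => t `^ (- (m / p))) \_ `]u, v[.
have mI : measurable (`]u, v[%classic : set R) by exact: measurable_itv.
have mgI : measurable_fun `]u, v[ g by exact: measurable_funS mg.
have mf1 : measurable_fun setT f1.
  apply/(measurable_restrictT _ mI); apply: measurable_funM.
    exact: measurableT_comp.
  by apply: measurable_funTS; exact: measurable_powR.
have mf2 : measurable_fun setT f2.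
  by apply/(measurable_restrictT _ mI); apply: measurable_funTS; exact: measurable_powR.
(* The exponent conjugate to [p], in a form whose inverse is at hand. *)
have q0 : 0 < (1 - p^-1)^-1.
  by rewrite invr_gt0 subr_gt0 invf_lt1.
have := hoelder mu mf1 mf2 p0 q0.
rewrite invrK addrC subrK => /(_ erefl).
rewrite Lnorm1 unlock invrK => H.
apply: le_trans; first apply: le_trans H.
  rewrite [leLHS]integral_mkcond le_eqVlt; apply/orP; left; apply/eqP.
  apply: eq_integral => x _; rewrite /f1 /f2 /= !patchE.
  case: ifPn => [|_]; last by rewrite mul0r normr0.
  rewrite inE/= in_itv/= => /andP[ux xv].
  have x0 : 0 < x by exact: le_lt_trans ux.
  rewrite -mulrA -powRD; last by rewrite (gt_eqF x0) implybT.
  by rewrite subrr powRr0 mulr1 normr_id.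
apply: lee_pmul; rewrite ?poweR_ge0//.
- apply: gt0_ler_poweR; rewrite ?in_itv/= ?leey ?andbT ?invr_ge0 ?(ltW p0)//.
  + by apply: integral_ge0.
  + by apply: integral_ge0 => x _; rewrite lee_fin mulr_ge0// powR_ge0.
  rewrite [leLHS](_ : _ = \int[mu]_(t in `]u, v[) (`|g t| `^ p * t `^ m)%:E)%E.
    apply: ge0_subset_integral => //.
      apply/measurable_EFinP; apply: measurable_funM.
        apply: (measurableT_comp (measurable_powR _)).
        exact: measurableT_comp.
      by apply: measurable_funTS; exact: measurable_powR.
    by move=> x _; rewrite lee_fin mulr_ge0// powR_ge0.
  rewrite [RHS]integral_mkcond; apply: eq_integral => x _.
  rewrite /f1 /= !patchE; case: ifPn => [|_].
    rewrite inE/= in_itv/= => /andP[ux xv].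
    rewrite normrM normr_id (ger0_norm (powR_ge0 _ _)) powRM// ?powR_ge0//.
    by rewrite -powRrM divfK// gt_eqF.
  by rewrite normr0 powR0// gt_eqF.
- rewrite le_eqVlt; apply/orP; left; apply/eqP; congr (_ `^ _)%E.
  rewrite [RHS]integral_mkcond; apply: eq_integral => x _.
  rewrite /f2 /= !patchE; case: ifPn => [_|_].
    (* [m / p] times the conjugate exponent is [m / (p - 1)]. *)
    rewrite (ger0_norm (powR_ge0 _ _)) -powRrM; congr (_ `^ _)%:E.
    by field; rewrite !subr_eq0 !gt_eqF.
  by rewrite normr0 powR0// gt_eqF.
Qed.


Lemma is_weak_derivative_weak_derivative T k y : (0 < k)%N ->
  (exists g, is_weak_derivative T k y g) ->
  is_weak_derivative T k y (weak_derivative T k y).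
Proof. by case: k => // k _ ex; exact: (xgetPex (fun=> 0) ex). Qed.

(** One summand is bounded by the whole sum. All summands being integrable, the extended real
    integral is finite and can be compared with the real-valued norm. *)
Lemma le_weighted_Wsp_norm T p w y (s k : nat) : 1 < p ->
  (forall t, 0 <= w t) -> weighted_Wsp T s p w y -> (k <= s)%N ->
  ((\int[mu]_(t in `]0%R, T[) (`|weak_derivative T k y t| `^ p * w t)%R%:E)
     `^ (p^-1)%R <= (weighted_Wsp_norm T s p w y)%:E)%E.
Proof.
move=> p1 w0 [y0 wy] ks; have p0 : 0 < p by lra.
have iw j : (j <= s)%N -> mu.-integrable `]0, T[
    (EFin \o (fun t => `|weak_derivative T j y t| `^ p * w t)).
  by case: j => [_|j js]; [case: y0|have [_ []] := wy j.+1 js].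
have isum : mu.-integrable `]0, T[ (EFin \o
    (fun t => (\sum_(j < s.+1) `|weak_derivative T j y t| `^ p) * w t)).
  rewrite (_ : _ \o _ = fun t => (\sum_(j < s.+1)
    (`|weak_derivative T j y t| `^ p * w t)%R%:E)%E).
    by apply: integrable_sum => // j _; apply: iw; rewrite -ltnS.
  by apply/funext => t /=; rewrite mulr_suml sumEFin.
rewrite -[X in (X `^ _)%E]fineK; last exact: integrable_fin_num (iw k ks).
rewrite poweR_EFin lee_fin /weighted_Wsp_norm.
apply: ge0_ler_powR; rewrite ?invr_ge0 ?(ltW p0)// ?nnegrE.
- by apply: Rintegral_ge0 => t _; rewrite mulr_ge0// powR_ge0.
- by apply: Rintegral_ge0 => t _; rewrite mulr_ge0// sumr_ge0// => j _; exact: powR_ge0.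
apply: (le_Rintegral _ (iw k ks) isum) => // t _.
rewrite ler_wpM2r//.
have ks1 : (k < s.+1)%N by [].
rewrite (bigD1 (Ordinal ks1))//= lerDl sumr_ge0// => j _; exact: powR_ge0.
Qed.

(** [Y s - Y x] is, up to sign, an integral of the weak second derivative, estimated by Hoelder's
    inequality on all of []u, v[]. Subadditivity bounds the remaining power integral by that over an
    interval of the same length starting at the origin. *)
Lemma derive_oscillation p T m y Y u v s x :
  1 < p -> 0 <= m -> m < p - 1 -> weighted_Wsp T 2 p (fun t => t `^ m) y ->
  derivable_oo_LRcontinuous y 0 T -> {within `[0, T], continuous Y} ->
  {in `]0, T[, derive1 y =1 Y} ->
  0 <= u -> v <= T -> u < s < v -> u < x < v ->
  `|Y s - Y x| <= ((1 - m / (p - 1))^-1) `^ (1 - p^-1) *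
    (v - u) `^ (1 - (1 + m) / p) * weighted_Wsp_norm T 2 p (fun t => t `^ m) y.
Proof.
move=> p1 m0 mp wy dy cY yY u0 vT.
(* The estimate is symmetric in [s] and [x], and trivial if they coincide. *)
wlog sx : s x / s < x => [hwlog sI xI|].
  have [sx|xs|->] := ltgtP s x; first exact: hwlog.
    by rewrite distrC; exact: hwlog.
  by rewrite subrr normr0 !mulr_ge0// powR_ge0.
move=> /andP[us sv] /andP[ux xv].
pose g := weak_derivative T 2 y.
have [_ /(_ 2%N erefl)[exg [mg _]]] := wy.
have wg : is_weak_derivative T 2 y g by exact: is_weak_derivative_weak_derivative.
have s0 : 0 < s by lra.
have xT : x < T by lra.
rewrite distrC (weak_derivative2_FTC dy cY yY wg s0 sx xT).
have ig : mu.-integrable `]s, x[ (EFin \o g).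
  have [_ lg _] := wg.
  by apply: integrableS (locally_integrable_itv lg s0 xT) => //; exact: subset_itvW.
rewrite -lee_fin EFin_normr_Rintegral//.
have mgs : measurable_fun `]s, x[ g.
  by case/integrableP : ig => /measurable_EFinP.
apply: (@le_trans _ _ (\int[mu]_(t in `]s, x[) `|g t|%:E)%E).
  by apply: le_abse_integral => //; exact/measurable_EFinP.
have mguv : measurable_fun `]u, v[ g.
  apply: measurable_funS mg => // t /=; rewrite !in_itv/= => /andP[*].
  by apply/andP; split; lra.
(* Enlarging the interval makes the bound independent of [s] and [x]. *)
apply: (@le_trans _ _ (\int[mu]_(t in `]u, v[) `|g t|%:E)%E).
  apply: ge0_subset_integral => //.
    by apply/measurable_EFinP; exact: measurableT_comp.
  by apply: subset_itvW; lra.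
apply: (le_trans (le_integral_norm_weighted m p1 mg u0 vT)).
(* Here [m < p - 1] enters: it makes the dual weight integrable at 0. *)
have nu0 : 0 < 1 - m / (p - 1) by rewrite subr_gt0 ltr_pdivrMr ?mul1r//; lra.
have uv : u < v by lra.
rewrite muleC EFinM; apply: lee_pmul; rewrite ?poweR_ge0//; last first.
  by apply: le_weighted_Wsp_norm => // t; exact: powR_ge0.
have := integral_powR_oo nu0 u0 uv.
rewrite [1 - _ - 1]addrAC subrr sub0r => ->; rewrite poweR_EFin lee_fin.
have ip : 0 < p^-1 < 1 by rewrite invr_gt0 invf_lt1; lra.
have nn : 0 <= (v `^ (1 - m / (p - 1)) - u `^ (1 - m / (p - 1))) / (1 - m / (p - 1)).
  rewrite divr_ge0 ?(ltW nu0)// subr_ge0 ge0_ler_powR ?nnegrE ?(ltW nu0)//; lra.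
apply: (@le_trans _ _ (((v - u) `^ (1 - m / (p - 1)) / (1 - m / (p - 1))) `^ (1 - p^-1))).
  apply: ge0_ler_powR; rewrite ?nnegrE//; first by lra.
    by rewrite divr_ge0 ?powR_ge0 ?(ltW nu0).
  rewrite ler_pM2r ?invr_gt0//; apply: powR_subadditive; rewrite ?(ltW uv)//.
  by rewrite nu0/= gerBl divr_ge0//; lra.
rewrite powRM ?powR_ge0 ?invr_ge0 ?(ltW nu0)// [leLHS]mulrC ler_wpM2l ?powR_ge0//.
(* The exponents multiply to [(p - 1 - m) / p]. *)
rewrite -powRrM (_ : _ * _ = 1 - (1 + m) / p)//.
by field; rewrite !gt_eqF//; lra.
Qed.

End weighted_hoelder.

(** * The error of the L1 scheme *)

Section L1_error.
Context {R : realType}.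
Notation mu := (@lebesgue_measure R).
Implicit Types (f g k y Y : R -> R) (T a b c d t M alpha tau : R).

Lemma Rintegral_itvoo_cst a b (r : R) : a < b ->
  \int[mu]_(s in `]a, b[) r = r * (b - a).
Proof.
move=> ab; have := lebesgue_measure_itv `]a, b[; rewrite /= lte_fin ab -EFinB => muab.
by rewrite Rintegral_cst//; congr (_ * _); exact: (congr1 fine muab).
Qed.

Lemma integrable_itvoo_cst a b (r : R) : mu.-integrable `]a, b[ (EFin \o cst r).
Proof.
apply: (@integrableS _ _ _ mu `[a, b]%classic); first exact: measurable_itv.
- by [].
- exact: subset_itvW.
apply: continuous_itv_integrable; apply: continuous_subspaceT.
exact: cst_continuous.
Qed.

(* The left-hand side is the integral of [(Y - d) (k - c)], since [Y - d] has mean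
   zero. *)
Lemma Rintegral_mean_zero_bound Y k a b c d M : a < b ->
  mu.-integrable `]a, b[ (EFin \o Y) -> mu.-integrable `]a, b[ (EFin \o k) ->
  mu.-integrable `]a, b[ (EFin \o (fun s => Y s * k s)) ->
  \int[mu]_(s in `]a, b[) Y s = d * (b - a) ->
  (forall s, a < s < b -> `|Y s - d| <= M) ->
  (forall s, a < s < b -> c <= k s) ->
  `|\int[mu]_(s in `]a, b[) (Y s * k s) - d * \int[mu]_(s in `]a, b[) k s| <=
  M * (\int[mu]_(s in `]a, b[) k s - c * (b - a)).
Proof.
move=> ab iY ik iYk Yd YM ck.
have mab : measurable (`]a, b[%classic : set R) by exact: measurable_itv.
have icst := integrable_itvoo_cst a b.
have ikc : mu.-integrable `]a, b[ (EFin \o (fun s => k s - c)).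
  exact: (integrableB _ ik (icst c)).
have idk : mu.-integrable `]a, b[ (EFin \o (fun s => d * k s)).
  exact: (integrableZl _ d ik).
have icY : mu.-integrable `]a, b[ (EFin \o (fun s => c * (Y s - d))).
  exact: (integrableZl _ c (integrableB _ iY (icst d))).
have iYdk : mu.-integrable `]a, b[ (EFin \o (fun s => Y s * k s - d * k s)).
  exact: (integrableB _ iYk idk).
have i0 : mu.-integrable `]a, b[
    (EFin \o (fun s => Y s * k s - d * k s - c * (Y s - d))).
  exact: (integrableB _ iYdk icY).
have -> : \int[mu]_(s in `]a, b[) (Y s * k s) - d * \int[mu]_(s in `]a, b[) k s =
    \int[mu]_(s in `]a, b[) (Y s * k s - d * k s - c * (Y s - d)).
  rewrite RintegralB// RintegralB// RintegralZl//.
  rewrite RintegralZl//; last exact: (integrableB _ iY (icst d)).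
  by rewrite RintegralB ?Rintegral_itvoo_cst ?Yd ?subrr ?mulr0 ?subr0//; exact: icst.
apply: (le_trans (le_normr_Rintegral _ i0)) => //.
rewrite -(Rintegral_itvoo_cst c ab) -RintegralB//; last exact: icst.
rewrite -RintegralZl//.
apply: le_Rintegral => //.
- exact: integrable_norm.
- exact: (integrableZl _ M ikc).
move=> s /=; rewrite in_itv/= => sab.
have -> : Y s * k s - d * k s - c * (Y s - d) = (Y s - d) * (k s - c) by ring.
rewrite normrM (@ger0_norm _ (k s - c)) ?subr_ge0 ?ck//.
by rewrite ler_wpM2r ?subr_ge0 ?ck ?YM.
Qed.

Lemma Rintegral_grid f tau n : 0 < tau ->
  mu.-integrable `]0, n%:R * tau[ (EFin \o f) ->
  \int[mu]_(s in `]0, n%:R * tau[) f s =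
  \sum_(i < n) \int[mu]_(s in `]i%:R * tau, i.+1%:R * tau[) f s.
Proof.
move=> tau0; elim: n => [|n IH] fi.
  by rewrite big_ord0 mul0r set_itvoo0 Rintegral_set0.
have le_n : n%:R * tau <= n.+1%:R * tau by rewrite ler_pM2r// ler_nat.
have fin : mu.-integrable `]0, n%:R * tau[ (EFin \o f).
  by apply: integrableS fi => //; apply: subset_itvl; rewrite bnd_simp.
rewrite big_ord_recr/= -IH// (Rintegral_itv_bndo_bndc fin).
rewrite -(@Rintegral_itvB _ _ _ _ (n%:R * tau) fi) ?bnd_simp ?mulr_ge0 ?(ltW tau0)//.
  by rewrite addrC subrK.
by rewrite ltr_pM2r// ltr_nat.
Qed.

(** Abel summation: the scheme becomes a weighted sum of the increments of [v], to be compared cell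
    by cell with the Caputo integral. *)
Lemma L1_summation_by_parts (v b : nat -> R) n : (0 < n)%N -> b 0%N = 1 ->
  v n - b (n - 1)%N * v 0%N -
    \sum_(1 <= i < n) (b (n - i - 1)%N - b (n - i)%N) * v i =
  \sum_(i < n) b (n - i.+1)%N * (v i.+1 - v i).
Proof.
case: n => // m _ b0; rewrite big_add1/= big_mkord.
under [RHS]eq_bigr do rewrite mulrBr.
(* The last summand of the first sum is [v m.+1], because of [b 0 = 1], and the first summand of the
   second carries [v 0]; the others pair up after an index shift. *)
rewrite sumrB big_ord_recr/= subnn b0 mul1r [X in _ = _ - X]big_ord_recl/=.
rewrite [RHS](_ : _ = v m.+1 - b (m.+1 - 1)%N * v 0%N -
  (\sum_(i < m) b (m.+1 - (lift ord0 i).+1)%N * v (lift ord0 i) -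
   \sum_(i < m) b (m.+1 - i.+1)%N * v i.+1)); last by ring.
rewrite -sumrB; congr (_ - _); apply: eq_bigr => i _.
by rewrite lift0 !subSS mulrBl -subnDA addn1.
Qed.


(** The kernel is nonnegative and its integral has a finite closed form. *)
Lemma integrable_kernel alpha t : 0 < t -> alpha < 1 ->
  mu.-integrable `]0, t[ (EFin \o (fun s => (t - s) `^ (- alpha))).
Proof.
move=> t0 a1; have th0 : 0 < 1 - alpha by lra.
have mk : measurable_fun `]0, t[ (fun s => (t - s) `^ (- alpha)).
  apply: (measurableT_comp (measurable_powR _)).
  by apply: measurable_funB; [exact: measurable_cst|exact: measurable_id].
apply/integrableP; split; first exact/measurable_EFinP.
have := integral_powR_subl_oo th0 t0 (lexx t); rewrite addrAC subrr sub0r => I.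
under eq_integral do rewrite /= ger0_norm ?powR_ge0//.
by rewrite I ltry.
Qed.

Lemma integrable_continuous_kernel alpha t Y : 0 < t -> alpha < 1 ->
  {within `[0, t], continuous Y} ->
  mu.-integrable `]0, t[ (EFin \o (fun s => Y s * (t - s) `^ (- alpha))).
Proof.
move=> t0 a1 cY; have ik := integrable_kernel t0 a1.
have iY := continuous_itv_integrable cY.
have sub : `]0, t[%classic `<=` (`[0, t]%classic : set R) by exact: subset_itvW.
apply: (integrableMr _ _ _ ik) => //.
  have : mu.-integrable `]0, t[ (EFin \o Y) by exact: integrableS iY.
  by case/integrableP => /measurable_EFinP.
have [M [Mreal YM]] := compact_bounded (continuous_compact cY (@segment_compact R 0 t)).
exists M; split => // x Mx s /sub st; apply: (YM x Mx).
by exists s.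
Qed.

(** Strictness of [b < t] matters: a negative power of 0 is 0 by convention, so the kernel drops to
    0 at [t]. *)
Lemma kernel_nondecreasing alpha t a b : 0 < alpha -> a <= b -> b < t ->
  (t - a) `^ (- alpha) <= (t - b) `^ (- alpha).
Proof.
move=> a0 ab bt; rewrite !powRN lef_pV2 ?posrE ?powR_gt0; try lra.
by apply: ge0_ler_powR; rewrite ?nnegrE; lra.
Qed.

Lemma L1_coef0 alpha : alpha < 1 -> L1_coef alpha 0 = 1.
Proof. by move=> a1; rewrite /L1_coef powR1 powR0 ?subr0// subr_eq0 gt_eqF. Qed.

(** The cell bounds [M * (W i - k (i%:R * tau) * tau)] telescope except on the last cell, whose
    kernel integral survives and gives the power of [tau]. *)
Lemma L1_error_bound alpha tau T y Y n M :
  0 < alpha -> alpha < 1 -> 0 < tau -> (0 < n)%N -> n%:R * tau <= T ->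
  derivable_oo_LRcontinuous y 0 T -> {within `[0, T], continuous Y} ->
  {in `]0, T[, derive1 y =1 Y} ->
  (forall i, (i < n)%N -> forall s x, i%:R * tau < s < i.+1%:R * tau ->
    i%:R * tau < x < i.+1%:R * tau -> `|Y s - Y x| <= M) ->
  `|caputo alpha y (n%:R * tau) - L1_scheme alpha tau y n| <=
  `|(Gamma (1 - alpha))^-1| * (M * (tau `^ (1 - alpha) / (1 - alpha))).
Proof.
move=> a0 a1 tau0 n0 ntT dy cY yY YM.
set t := n%:R * tau; pose k (s : R) := (t - s) `^ (- alpha).
have t0 : 0 < t by rewrite mulr_gt0// ltr0n.
have T0 : 0 < T by exact: lt_le_trans ntT.
have sub0 : `[0, t]%classic `<=` (`[0, T]%classic : set R).
  by apply: subset_itvl; rewrite bnd_simp.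
have cYt : {within `[0, t], continuous Y} by exact: continuous_subspaceW cY.
have ik := integrable_kernel t0 a1.
have iYk := integrable_continuous_kernel t0 a1 cYt.
(* [d] is the slope of the piecewise linear interpolant, which the scheme uses in place of [Y]. *)
pose J i := \int[mu]_(s in `]i%:R * tau, i.+1%:R * tau[) (Y s * k s).
pose W i := \int[mu]_(s in `]i%:R * tau, i.+1%:R * tau[) k s.
pose d i := (y (i.+1%:R * tau) - y (i%:R * tau)) / tau.
have caputoE : caputo alpha y t = (Gamma (1 - alpha))^-1 * \sum_(i < n) J i.
  rewrite /caputo; congr (_ * _); rewrite -Rintegral_grid//.
  apply: eq_Rintegral => s; rewrite inE/= in_itv/= => /andP[s0 st].
  by rewrite yY ?in_itv/= ?s0 ?(lt_le_trans st)// /k powRN.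
have grid_lt i : i%:R * tau < i.+1%:R * tau by rewrite ltr_pM2r// ltr_nat.
have grid_ge0 i : 0 <= i%:R * tau by rewrite mulr_ge0// ltW.
have grid_le i : (i < n)%N -> i.+1%:R * tau <= t by move=> ?; rewrite ler_pM2r// ler_nat.
have gridB i : i.+1%:R * tau - i%:R * tau = tau by rewrite -natr1; ring.
have subi i : (i < n)%N ->
    `]i%:R * tau, i.+1%:R * tau[%classic `<=` (`]0, t[%classic : set R).
  by move=> ilt; apply: subset_itv; rewrite bnd_simp// grid_le.
(* The kernel integral depends only on how many cells lie between cell [i] and [t], hence the index
   [n - i.+1]. *)
have WE i : (i < n)%N -> W i =
    tau `^ (1 - alpha) / (1 - alpha) * L1_coef alpha (n - i.+1).
  move=> ilt; have th0 : 0 < 1 - alpha by lra.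
  have := integral_powR_subl_oo th0 (grid_lt i) (grid_le _ ilt).
  rewrite [1 - alpha - 1]addrAC subrr sub0r /W /Rintegral /k => ->/=.
  rewrite /t -!mulrBl -!natrB//; last exact: ltnW.
  rewrite !powRM ?(ltW tau0)// /L1_coef subnSK//; ring.
have L1E : L1_scheme alpha tau y n =
    (Gamma (1 - alpha))^-1 * \sum_(i < n) d i * W i.
  rewrite /L1_scheme -[y 0](_ : y (0%:R * tau) = _); last by rewrite mul0r.
  rewrite (@L1_summation_by_parts (fun i => y (i%:R * tau)) (L1_coef alpha))//; last first.
    exact: L1_coef0.
  (* The recurrence of Gamma supplies the factor [1 - alpha] that occurs in [WE]. *)
  rewrite (_ : 2 - alpha = (1 - alpha) + 1); last by ring.
  rewrite GammaS; last by lra.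
  rewrite mulr_sumr [RHS]mulr_sumr; apply: eq_bigr => i _.
  rewrite WE// /d (_ : tau `^ (1 - alpha) = tau `^ (- alpha) * tau); last first.
    by rewrite -[X in _ * X]powRr1 ?(ltW tau0)// -powRD ?(gt_eqF tau0) ?implybT// addrC.
  have tauN0 : tau != 0 by rewrite gt_eqF.
  have thN0 : 1 - alpha != 0 by rewrite gt_eqF// subr_gt0.
  (* The inverse becomes an opaque factor; otherwise [field] would ask for [Gamma (1 - alpha)] to be
     nonzero. *)
  rewrite invfM; move: (Gamma _)^-1 => G.
  by field; rewrite tauN0 thN0.
have cell i : (i < n)%N -> `|J i - d i * W i| <= M * (W i - k (i%:R * tau) * tau).
  move=> ilt; rewrite -[X in _ <= M * (_ - _ * X)](gridB i).
  have ioo : `]i%:R * tau, i.+1%:R * tau[%classic `<=` (`]0, t[%classic : set R).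
    exact: subi.
  have icc : `[i%:R * tau, i.+1%:R * tau]%classic `<=` (`[0, T]%classic : set R).
    apply: subset_itv; rewrite bnd_simp//; exact: le_trans (grid_le _ ilt) ntT.
  have cYi : {within `[i%:R * tau, i.+1%:R * tau], continuous Y}.
    exact: continuous_subspaceW cY.
  have dyi : derivable_oo_LRcontinuous y (i%:R * tau) (i.+1%:R * tau).
    exact: derivable_oo_continuousW dy.
  have inT s : s \in `]i%:R * tau, i.+1%:R * tau[ -> s \in `]0, T[.
    by move=> /ioo /=; rewrite !in_itv/= => /andP[-> st]/=; exact: lt_le_trans ntT.
  have yYi : {in `]i%:R * tau, i.+1%:R * tau[, derive1 y =1 Y}.
    by move=> s /inT; exact: yY.
  have iYi : mu.-integrable `]i%:R * tau, i.+1%:R * tau[ (EFin \o Y).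
    apply: (@integrableS _ _ _ mu `[i%:R * tau, i.+1%:R * tau]%classic) => //.
      exact: subset_itvW.
    exact: continuous_itv_integrable.
  have Yd : \int[mu]_(s in `]i%:R * tau, i.+1%:R * tau[) Y s =
      d i * (i.+1%:R * tau - i%:R * tau).
    rewrite gridB /d divfK ?gt_eqF// /Rintegral.
    have := continuous_FTC2 (grid_lt i) cYi dyi yYi.
    rewrite integral_itv_bndoo; last by case/integrableP : iYi.
    by move=> ->.
  apply: Rintegral_mean_zero_bound => //.
  - exact: integrableS ik.
  - exact: integrableS iYk.
  (* By the mean value theorem [d i] is a value of [Y] inside the cell, so the oscillation bound
     applies to [Y s - d i]. *)
  - have dY s : s \in `]i%:R * tau, i.+1%:R * tau[ -> is_derive s 1 y (Y s).
      move=> sI; rewrite -yYi// derive1E; apply: derivableP.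
      by have [+ _ _] := dyi; exact.
    have [x xI yx] := MVT (grid_lt i) dY (derivable_oo_LRcontinuous_within dyi).
    move=> s sI; rewrite /d yx gridB mulfK ?gt_eqF//.
    by apply: (YM i) => //; move: xI; rewrite in_itv.
  - move=> s /andP[h1 h2]; apply: kernel_nondecreasing; rewrite ?(ltW h1)//.
    exact: lt_le_trans (grid_le _ ilt).
rewrite caputoE L1E -mulrBr normrM ler_wpM2l// -sumrB.
apply: (le_trans (ler_norm_sum _ _ _)).
apply: (@le_trans _ _ (\sum_(i < n) M * (W i - k (i%:R * tau) * tau))).
  by apply: ler_sum => i _; exact: cell.
(* Both points are taken at the middle of the first cell. *)
have M0 : 0 <= M.
  have h : 0%:R * tau < tau / 2 < 1%:R * tau by rewrite mul0r mul1r; lra.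
  by have := YM 0%N n0 _ _ h h; rewrite subrr normr0.
rewrite -mulr_sumr ler_wpM2l//.
(* The kernel is at most its value at the right end of the cell. The last cell is left out, its
   right end being the singularity. *)
have Wle i : (i.+1 < n)%N -> W i <= k (i.+1%:R * tau) * tau.
  move=> ilt; rewrite -[X in _ <= _ * X](gridB i) -Rintegral_itvoo_cst//.
  apply: le_Rintegral => //.
  - by apply: integrableS ik => //; apply: subi; exact: ltnW.
  - exact: integrable_itvoo_cst.
  - move=> s /=; rewrite in_itv/= => /andP[h1 h2].
    apply: kernel_nondecreasing; rewrite ?(ltW h2)//.
    by rewrite ltr_pM2r// ltr_nat.
have mn := prednK n0; set m := n.-1 in mn.
have mltn : (m < n)%N by rewrite -mn.
pose F i := W i - k (i%:R * tau) * tau.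
have -> : \sum_(i < n) (W i - k (i%:R * tau) * tau) = \sum_(i < m) F i + F m.
  by rewrite -(big_mkord xpredT F) -mn big_nat_recr//= big_mkord.
rewrite {2}/F (WE _ mltn) mn subnn.
rewrite L1_coef0// mulr1.
have tel : \sum_(i < m) F i <= k (m%:R * tau) * tau - k (0%:R * tau) * tau.
  rewrite -(telescope_sumr (fun i => k (i%:R * tau) * tau) (leq0n m)) big_mkord.
  by apply: ler_sum => i _; rewrite lerB// Wle// -mn ltnS.
(* The term at 0 enters the telescoped sum with a minus sign and is dropped; the term at [m] cancels
   against the last cell. *)
have k0 : 0 <= k (0%:R * tau) * tau by rewrite mulr_ge0 ?powR_ge0// ltW.
by lra.
Qed.

End L1_error.

Theorem corollary1 (R : realType) (alpha p T mu : R)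
    (halpha0 : 0 < alpha) (halpha1 : alpha < 1) (hp : 1 < p) (hT : 0 < T)
    (hmu0 : 0 <= mu) (hmup : mu < p - 1) :
  exists C : R, 0 < C /\
    forall y : R -> R,
      weighted_Wsp T 2 p (fun t => t `^ mu) y ->
      C1_on T y ->
      forall (N : nat), (1 <= N)%N ->
      forall (n : nat), (1 <= n <= N)%N ->
        `|caputo alpha y (n%:R * (T / N%:R)) - L1_scheme alpha (T / N%:R) y n|
        <= C * (T / N%:R) `^ (2 - alpha - (1 + mu) / p)
             * weighted_Wsp_norm T 2 p (fun t => t `^ mu) y.
Proof.
(* [G] is the prefactor of the Caputo derivative and [K] the constant of [derive_oscillation]; the
   division by [1 - alpha] below comes from the kernel integral over the last cell. *)
pose G := `|(Gamma (1 - alpha))^-1|.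
pose K := ((1 - mu / (p - 1))^-1) `^ (1 - p^-1).
have K0 : 0 <= K by exact: powR_ge0.
have G0 : 0 <= G by exact: normr_ge0.
have th0 : 0 < 1 - alpha by lra.
have C0 : 0 <= G * (K / (1 - alpha)) by rewrite mulr_ge0// divr_ge0// ltW.
(* Adding 1 makes the constant positive, [G] and [K] being known only as nonnegative. *)
exists (G * (K / (1 - alpha)) + 1); split; first by rewrite ltr_wpDl.
move=> y wy [dy [Y [cY yY]]] N N1 n /andP[n1 nN].
set tau := T / N%:R; set nrm := weighted_Wsp_norm _ _ _ _ _.
have N0 : 0 < N%:R :> R by rewrite ltr0n.
have tau0 : 0 < tau by rewrite divr_gt0.
have ntT : n%:R * tau <= T.
  by rewrite mulrCA ler_piMr ?(ltW hT)// ler_pdivrMr// mul1r ler_nat.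
have nrm0 : 0 <= nrm by exact: powR_ge0.
have osc i : (i < n)%N -> forall s x, i%:R * tau < s < i.+1%:R * tau ->
    i%:R * tau < x < i.+1%:R * tau ->
    `|Y s - Y x| <= K * tau `^ (1 - (1 + mu) / p) * nrm.
  move=> ilt s x sI xI.
  have -> : tau = i.+1%:R * tau - i%:R * tau by rewrite -natr1; ring.
  apply: derive_oscillation => //; first by rewrite mulr_ge0// ltW.
  by apply: le_trans ntT; rewrite ler_pM2r// ler_nat.
apply: (le_trans (L1_error_bound halpha0 halpha1 tau0 n1 ntT dy cY yY osc)).
(* The first exponent is that of the oscillation, the second that of the kernel on the last cell. *)
have -> : 2 - alpha - (1 + mu) / p = (1 - (1 + mu) / p) + (1 - alpha) by ring.
rewrite (@powRD _ tau _ (1 - alpha)); last by rewrite (gt_eqF tau0) implybT.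
set A := tau `^ (1 - (1 + mu) / p); set B := tau `^ (1 - alpha).
have AB0 : 0 <= A * B * nrm by rewrite !mulr_ge0// powR_ge0.
apply: (@le_trans _ _ (G * (K / (1 - alpha)) * (A * B * nrm))).
  by rewrite le_eqVlt; apply/orP; left; apply/eqP; rewrite -/G; ring.
by rewrite -[leRHS]mulrA ler_wpM2r// lerDl.
Qed.
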